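(* The proof system $\mathbb{SKH}$ is sound: for every formula $\varphi$ of the language, if $\vdash\varphi$ (i.e. $\varphi$ is derivable in $\mathbb{SKH}$) then $\vDash\varphi$ (i.e. $\mathcal{M},s\vDash\varphi$ for every model $\mathcal{M}$ and every state $s$ of $\mathcal{M}$).
   Context: **Language.** $\mathrm{PROP}$ is a countable set of propositional symbols. Formulas: $\phi ::= p\mid\neg\phi\mid(\phi\wedge\phi)\mid\mathcal{K}\phi\mid\mathcal{K}h\,\phi$ with $p\in\mathrm{PROP}$; $\bot,\vee,\to$ are the usual abbreviations. **Models.** A model is $\mathcal{M}=\langle W,\mathrm{ACT},\sim,\{\xrightarrow{a}\mid a\in\mathrm{ACT}\},V\rangle$ where $W$ is a non-empty set, $\mathrm{ACT}$ is a set of actions, $\sim$ is an equivalence relation on $W$, each $\xrightarrow{a}$ is a binary relation on $W$, and $V:W\to 2^{\mathrm{PROP}}$. No relationship between $\sim$ and the $\xrightarrow{a}$ is assumed. $[s]$ is the $\sim$-class of $s$ and $[W]$ the set of all $\sim$-classes. An action $a$ is executable at a state $s$ if $s\xrightarrow{a}t$ for some $t$. Write $[s]\xrightarrow{a}[t]$ if there are $s'\in[s]$, $t'\in[t]$ with $s'\xrightarrow{a}t'$. **Strategies.** A strategy is a partial function $\sigma:[W]\to\mathrm{ACT}$ with domain $\mathrm{dom}(\sigma)$ such that for every $[s]\in\mathrm{dom}(\sigma)$ the action $\sigma([s])$ is executable at every $s'\in[s]$. The empty function is a strategy. **Executions.** A possible execution of $\sigma$ is a non-empty, finite or infinite, sequence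 $[s_0][s_1]\cdots$ of classes such that for every $i$ for which $[s_{i+1}]$ occurs in the sequence, $[s_i]\in\mathrm{dom}(\sigma)$ and $[s_i]\xrightarrow{\sigma([s_i])}[s_{i+1}]$. For a finite execution $[s_0]\cdots[s_n]$, $[s_n]$ is its leaf-node. An execution is complete if it is infinite or its leaf-node is not in $\mathrm{dom}(\sigma)$. $\mathrm{CELeaf}(\sigma,s)$ is the set of all leaf-nodes of (finite) complete executions of $\sigma$ starting from $[s]$. **Semantics.** $\mathcal{M},s\vDash p$ iff $p\in V(s)$; Boolean cases as usual; $\mathcal{M},s\vDash\mathcal{K}\phi$ iff $\mathcal{M},s'\vDash\phi$ for all $s'\sim s$; $\mathcal{M},s\vDash\mathcal{K}h\,\phi$ iff there is a strategy $\sigma$ such that (1) $[t]\subseteq\{u\in W\mid\mathcal{M},u\vDash\phi\}$ for all $[t]\in\mathrm{CELeaf}(\sigma,s)$, and (2) all complete executions of $\sigma$ starting from $[s]$ are finite. **System $\mathbb{SKH}$.** Axioms (with $p,q$ propositional symbols): all axioms of propositional logic (all propositional tautologies); $\mathcal{K}p\wedge\mathcal{K}(p\to q)\to\mathcal{K}q$; $\mathcal{K}p\to p$; $\mathcal{K}p\to\mathcal{K}\mathcal{K}p$; $\neg\mathcal{K}p\to\mathcal{K}\neg\mathcal{K}p$; $\mathcal{K}p\to\mathcal{K}h\,p$; $\mathcal{K}h\,p\to\mathcal{K}h\,\mathcal{K}p$; $\mathcal{K}h\,p\to\mathcal{K}\mathcal{K}h\,p$; $\mathcal{K}h\,\mathcal{K}h\,p\to\mathcal{K}h\,p$;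 $\mathcal{K}h\,\bot\to\bot$. Rules: from $\varphi$ and $\varphi\to\psi$ infer $\psi$; from $\varphi$ infer $\mathcal{K}\varphi$; from $\varphi\to\psi$ infer $\mathcal{K}h\,\varphi\to\mathcal{K}h\,\psi$; from $\varphi(p)$ infer $\varphi[\psi/p]$ (uniform substitution of $\psi$ for $p$). $\vdash\varphi$ means $\varphi$ is derivable. *)

(* Defs.v *)
From mathcomp Require Import all_boot.
From mathcomp Require Import classical_sets.
From Stdlib Require Import RelationClasses.

Set Implicit Arguments.
Unset Strict Implicit.
Unset Printing Implicit Defensive.

Local Open Scope classical_set_scope.

Inductive form (PROP : countType) : Type :=
| Atom of PROP
| Neg of form PROP
| And of form PROP & form PROP
| K of form PROP
| Kh of form PROP.

Definition Imp (PROP : countType) (f g : form PROP) : form PROP :=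
  Neg (And f (Neg g)).

(* The abbreviation of falsum depends on a symbol [p]; see [Ax_KhBot]. *)
Definition Bot (PROP : countType) (p : PROP) : form PROP :=
  And (Atom p) (Neg (Atom p)).

Record model (PROP : countType) : Type := Model {
  world : Type;
  world_nonempty : inhabited world;
  act : Type;
  sim : world -> world -> Prop;
  sim_equiv : Equivalence sim;
  trans : act -> world -> world -> Prop;
  val : world -> set PROP
}.

Section Strategies.
Variables (PROP : countType) (M : model PROP).

Definition executable (a : act M) (s : world M) : Prop :=
  exists t, trans a s t.

Definition class_of (s : world M) : set (world M) := [set t | sim s t].

Record eclass : Type := EClass {
  eset :> set (world M);
  esetP : exists s, eset = class_of s
}.

Definition cls (s : world M) : eclass :=
  EClass (ex_intro (fun s' => class_of s = class_of s') s erefl).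

Definition ctrans (a : act M) (C D : eclass) : Prop :=
  exists s' t', [/\ eset C s', eset D t' & trans a s' t'].

(* [None] means that the class is outside the domain. *)
Record strategy : Type := Strategy {
  strat :> eclass -> option (act M);
  strat_exec : forall (C : eclass) (a : act M),
    strat C = Some a -> forall s', eset C s' -> executable a s'
}.

Inductive cseq : Type :=
| FinSeq (C0 : eclass) (r : seq eclass) (* the non-empty sequence C0 :: r *)
| InfSeq (c : nat -> eclass).

Definition cseq_at (e : cseq) (i : nat) : option eclass :=
  match e with
  | FinSeq C0 r => onth (C0 :: r) i
  | InfSeq c => Some (c i)
  end.

Definition finite_cseq (e : cseq) : Prop :=
  match e with FinSeq _ _ => True | InfSeq _ => False end.

(* [D] is the last element of the sequence, which is finite. *)
Definition is_leaf (e : cseq) (D : eclass) : Prop :=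
  match e with FinSeq C0 r => D = last C0 r | InfSeq _ => False end.

Definition starts_from (e : cseq) (C : eclass) : Prop := cseq_at e 0 = Some C.

Definition possible_execution (sigma : strategy) (e : cseq) : Prop :=
  forall i C D, cseq_at e i = Some C -> cseq_at e i.+1 = Some D ->
    exists2 a, sigma C = Some a & ctrans a C D.

Definition complete_execution (sigma : strategy) (e : cseq) : Prop :=
  possible_execution sigma e /\
  (~ finite_cseq e \/ exists2 D, is_leaf e D & sigma D = None).

Definition CELeaf (sigma : strategy) (s : world M) : set eclass :=
  [set D | exists e, [/\ complete_execution sigma e,
                         starts_from e (cls s) & is_leaf e D]].

End Strategies.

Fixpoint sat (PROP : countType) (M : model PROP) (s : world M)
    (f : form PROP) {struct f} : Prop :=
  match f with
  | Atom p => val s p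
  | Neg g => ~ sat s g
  | And g h => sat s g /\ sat s h
  | K g => forall s', sim s s' -> sat s' g
  | Kh g => exists sigma : strategy M,
      (forall T : eclass M, CELeaf sigma s T -> eset T `<=` [set u | sat u g])
      /\ (forall e : cseq M, complete_execution sigma e ->
            starts_from e (cls s) -> finite_cseq e)
  end.

Definition valid (PROP : countType) (f : form PROP) : Prop :=
  forall (M : model PROP) (s : world M), sat s f.

Fixpoint subst (PROP : countType) (p : PROP) (g f : form PROP) : form PROP :=
  match f with
  | Atom q => if q == p then g else Atom q
  | Neg f1 => Neg (subst p g f1)
  | And f1 f2 => And (subst p g f1) (subst p g f2)
  | K f1 => K (subst p g f1)
  | Kh f1 => Kh (subst p g f1)
  end.

(* Truth-functional evaluation: symbols and modal formulas count as atoms. *)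
Fixpoint beval (PROP : countType) (v : form PROP -> bool) (f : form PROP)
    : bool :=
  match f with
  | Neg g => ~~ beval v g
  | And g h => beval v g && beval v h
  | _ => v f
  end.

Definition tautology (PROP : countType) (f : form PROP) : Prop :=
  forall v : form PROP -> bool, beval v f.

Inductive SKH (PROP : countType) : form PROP -> Prop :=
| Ax_Taut f : tautology f -> SKH f
| Ax_DistK (p q : PROP) :
    SKH (Imp (And (K (Atom p)) (K (Imp (Atom p) (Atom q)))) (K (Atom q)))
| Ax_T (p : PROP) : SKH (Imp (K (Atom p)) (Atom p))
| Ax_4 (p : PROP) : SKH (Imp (K (Atom p)) (K (K (Atom p))))
| Ax_5 (p : PROP) : SKH (Imp (Neg (K (Atom p))) (K (Neg (K (Atom p)))))
| Ax_KtoKh (p : PROP) : SKH (Imp (K (Atom p)) (Kh (Atom p)))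
| Ax_KhtoKhK (p : PROP) : SKH (Imp (Kh (Atom p)) (Kh (K (Atom p))))
| Ax_KhtoKKh (p : PROP) : SKH (Imp (Kh (Atom p)) (K (Kh (Atom p))))
| Ax_KhKh (p : PROP) : SKH (Imp (Kh (Kh (Atom p))) (Kh (Atom p)))
(* One instance per symbol that may be used to abbreviate falsum; by [R_Sub]
   each of them yields all the others. *)
| Ax_KhBot (p : PROP) : SKH (Imp (Kh (Bot p)) (Bot p))
| R_MP f g : SKH f -> SKH (Imp f g) -> SKH g
| R_NecK f : SKH f -> SKH (K f)
| R_MonoKh f g : SKH (Imp f g) -> SKH (Imp (Kh f) (Kh g))
| R_Sub f (g : form PROP) (p : PROP) : SKH f -> SKH (subst p g f).

(* Main.v *)
(* Knowing how is a least fixed point: [Kh g] holds at [s] iff [s] belongs to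
   the smallest set containing the states whose class lies in [g] and the
   states whose class admits a uniformly executable action all of whose
   outcomes are already in the set.  A strategy all of whose executions
   terminate in [g] stays in this set, since outside of it one could build an
   infinite execution.  Conversely, a well-order on strategies glues all
   strategies terminating in [g] into a single one: each class uses the least
   strategy that terminates from it, and along an execution this index never
   increases.  The glued strategy is then extended by one action at a time.
   With this characterization every axiom for [Kh] is a short induction, and
   substitution amounts to changing the valuation. *)
Require Import Defs.
From mathcomp Require Import all_boot.
From mathcomp Require Import boolp classical_sets wochoice.
From Stdlib Require Import RelationClasses.

Set Implicit Arguments.
Unset Strict Implicit.
Unset Printing Implicit Defensive.

Local Open Scope classical_set_scope.

(** Zermelo's theorem: least elements will select one strategy per class, and antisymmetry will
    identify strategies that lie below each other. *)
Lemma exists_well_order (T : Type) : exists R : T -> T -> Prop,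
  (forall x y, R x y -> R y x -> x = y) /\
  (forall A : set T, A !=set0 -> exists2 z, A z & forall y, A y -> R z y).
Proof.
have [R wR] := @well_ordering_principle {classic T}.
have antiR := wo_chain_antisymmetric (C := predT) (@withinW _ predT _ wR).
exists R; split=> [x y xy yx|A [x Ax]].
  by apply: antiR => //; rewrite xy yx.
have [|z [[/asboolP Az minz] _]] := wR (fun y => `[< A y >]).
  by exists x; exact/asboolP.
by exists z => // y Ay; apply: minz; exact/asboolP.
Qed.

(** * The least fixed point, over bare relations *)

Section KnowHow.
Variables (W A : Type) (sim : W -> W -> Prop) (trans : A -> W -> W -> Prop).

(** Outcomes are states, not classes; by [knowhow_sim] this is the same requirement when [sim] is an
    equivalence. *)
Inductive knowhow (P : set W) : W -> Prop :=
| knowhow_stop s : (forall t, sim s t -> P t) -> knowhow P s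
| knowhow_act s a :
    (forall s', sim s s' -> exists t, trans a s' t) ->
    (forall s' t, sim s s' -> trans a s' t -> knowhow P t) ->
    knowhow P s.

Lemma knowhowS (P Q : set W) s : P `<=` Q -> knowhow P s -> knowhow Q s.
Proof.
move=> PQ; elim=> {s} [s Ps|s a ex _ IH]; last exact: knowhow_act ex IH.
by apply: knowhow_stop => t /Ps/PQ.
Qed.

(** An executable action has an outcome, so a derivation leads to a stopping class, which is
    inhabited by reflexivity. *)
Lemma knowhow0 s : Reflexive sim -> ~ knowhow set0 s.
Proof.
move=> simxx; elim=> {s} [s Ps|s a ex _ IH]; first exact: Ps (simxx s).
by have [t st] := ex s (simxx s); exact: IH (simxx s) st.
Qed.

(** Replacing each stopping node by the derivation found there concatenates the two plans. *)
Lemma knowhow_idem (P : set W) s :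
  Reflexive sim -> knowhow (knowhow P) s -> knowhow P s.
Proof.
move=> simxx; elim=> {s} [s /(_ s (simxx s)) //|s a ex _ IH].
exact: knowhow_act ex IH.
Qed.

Hypothesis sim_equiv : Equivalence sim.

Lemma knowhow_sim (P : set W) s s' : sim s s' -> knowhow P s -> knowhow P s'.
Proof.
move=> /[swap] -[{}s Ps|{}s a ex kh] ss'.
  by apply: knowhow_stop => t /(transitivity ss'); exact: Ps.
apply: knowhow_act (fun t s't => ex t (transitivity ss' s't)) _.
by move=> t u s't; apply: kh (transitivity ss' s't).
Qed.

(** Stopping demands [P] on a whole class, so [P] is known at each of its states. *)
Lemma knowhow_known (P : set W) s :
  knowhow P s -> knowhow [set t | forall u, sim t u -> P u] s.
Proof.
elim=> {s} [s Ps|s a ex _ IH]; last exact: knowhow_act ex IH.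
by apply: knowhow_stop => t st u /(transitivity st); exact: Ps.
Qed.

End KnowHow.

Section Semantics.
Variables (PROP : countType) (M : model PROP).
Implicit Types (s t : world M) (C D : eclass M) (sigma : strategy M).
Implicit Types (P : set (world M)) (e : cseq M).

#[local] Instance sim_equivalence : Equivalence (@sim PROP M) := sim_equiv M.

Lemma eclass_inj C D : eset C = eset D -> C = D.
Proof.
case: C D => [C pC] [D pD] /= eCD; rewrite eCD in pC *.
by congr EClass; exact: Prop_irrelevance.
Qed.

Lemma mem_cls s : eset (cls s) s.
Proof. exact: (reflexivity s). Qed.

Lemma mem_clsE C s : eset C s -> C = cls s.
Proof.
case: C => C [t eC] /= Cs; apply: eclass_inj => /=; move: Cs; rewrite eC => ts.
apply/seteqP; split=> u tu; first exact: transitivity (symmetry ts) tu.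
exact: transitivity ts tu.
Qed.

Lemma cls_surj C : exists s, C = cls s.
Proof. by case: C => C [s eC]; exists s; exact: eclass_inj. Qed.

(** * Prepending a class to a sequence of classes *)

Definition ccons C e : cseq M :=
  match e with
  | FinSeq D r => FinSeq C (D :: r)
  | InfSeq c => InfSeq (fun i => if i is j.+1 then c j else C)
  end.

Lemma cseq_at_ccons C e i : cseq_at (ccons C e) i.+1 = cseq_at e i.
Proof. by case: e. Qed.

Lemma starts_from_ccons C D e : starts_from (ccons D e) C -> D = C.
Proof. by case: e => [? ?|?] []. Qed.

Lemma finite_ccons C e : finite_cseq (ccons C e) <-> finite_cseq e.
Proof. by case: e. Qed.

Lemma is_leaf_ccons C e D : is_leaf (ccons C e) D <-> is_leaf e D.
Proof. by case: e. Qed.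

Lemma starts_from_ex e : exists C, starts_from e C.
Proof. by case: e => [C r|c]; [exists C | exists (c 0)]. Qed.

Lemma cseqE e : (exists C, e = FinSeq C [::]) \/ exists C e', e = ccons C e'.
Proof.
case: e => [C [|D r]|c]; first by left; exists C.
  by right; exists C, (FinSeq D r).
right; exists (c 0), (InfSeq (c \o S)); congr InfSeq.
by apply: funext; case.
Qed.

(** Leaves and finiteness depend only on the tail, so the sole new condition is the first
    transition. *)
Lemma complete_ccons sigma C D e : starts_from e D ->
  complete_execution sigma (ccons C e) <->
  (exists2 a, sigma C = Some a & ctrans a C D) /\ complete_execution sigma e.
Proof.
move=> eD; have e0 : cseq_at (ccons C e) 0 = Some C by case: (e).
have leafE : (exists2 D, is_leaf (ccons C e) D & sigma D = None) <->
    (exists2 D, is_leaf e D & sigma D = None).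
  by split=> -[E /is_leaf_ccons ? ?]; exists E.
rewrite /complete_execution leafE finite_ccons; split=> [[ex ?]|[st [ex ?]]].
  split; first by apply: ex e0 _; rewrite cseq_at_ccons.
  by split=> // i E F Ei Fi; apply: (ex i.+1); rewrite cseq_at_ccons.
split=> // -[|i] E F; rewrite !cseq_at_ccons; last exact: ex.
by rewrite e0 [in X in _ -> X -> _]eD => -[<-] [<-].
Qed.

(** * Strategies that terminate in a given set *)

Definition terminating sigma P C : Prop :=
  (forall e D, complete_execution sigma e -> starts_from e C -> is_leaf e D ->
     eset D `<=` P) /\
  (forall e, complete_execution sigma e -> starts_from e C -> finite_cseq e).

Lemma terminating_stop sigma P C :
  terminating sigma P C -> sigma C = None -> eset C `<=` P.
Proof.
move=> [leafP _] CN; apply: (leafP (FinSeq C [::])) => //; split.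
  by move=> i E F /=; case: i.
by right; exists C.
Qed.

Lemma terminating_step sigma P C a D :
  terminating sigma P C -> sigma C = Some a -> ctrans a C D ->
  terminating sigma P D.
Proof.
move=> [leafP fin] Ca CD.
have cc e : complete_execution sigma e -> starts_from e D ->
    complete_execution sigma (ccons C e) /\ starts_from (ccons C e) C.
  move=> ex eD; split; last by case: (e).
  by apply/(complete_ccons _ _ eD); split=> //; exists a.
split=> [e E ex eD eE|e ex eD]; have [ex' eC] := cc e ex eD.
  by apply: leafP ex' eC _; apply/is_leaf_ccons.
by apply/(finite_ccons C)/fin.
Qed.

Lemma knowhow_of_terminating sigma P s :
  terminating sigma P (cls s) -> knowhow (@sim _ M) (@trans _ M) P s.
Proof.
pose bad t := terminating sigma P (cls t) /\
              ~ knowhow (@sim _ M) (@trans _ M) P t.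
move=> term_s; apply: contrapT => Nkh.
(* At a bad state the strategy must act and some outcome is bad again; otherwise a constructor of
   [knowhow] would apply. *)
have step (t : {t | bad t}) : exists u : {t | bad t}, exists2 a,
    sigma (cls (sval t)) = Some a & ctrans a (cls (sval t)) (cls (sval u)).
  case: t => t [term_t Nkh_t] /=; case ta: (sigma (cls t)) => [a|]; last first.
    by case: Nkh_t; apply: knowhow_stop; exact: terminating_stop ta.
  apply: contrapT => Nu; apply: Nkh_t; apply: (@knowhow_act _ _ _ _ _ _ a).
    by move=> t' tt'; exact: (strat_exec ta).
  move=> t' u tt' t'u; apply: contrapT => Nkh_u.
  have tu : ctrans a (cls t) (cls u).
    by exists t', u; split=> //; exact: mem_cls.
  by apply: Nu; exists (exist _ u (conj (terminating_step term_t ta tu) Nkh_u));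
    exists a.
have [f fP] := choice step.
(* Iterating the choice yields an infinite execution, against termination. *)
pose c i := cls (sval (iter i f (exist bad s (conj term_s Nkh)))).
have [_ /(_ (InfSeq c))] := term_s; apply=> //; split; last by left.
by move=> i C D [<-] [<-]; exact: fP.
Qed.

(** * Inductive termination and the gluing of strategies *)

Inductive reaches sigma P C : Prop :=
| reaches_stop : sigma C = None -> eset C `<=` P -> reaches sigma P C
| reaches_act a : sigma C = Some a ->
    (forall D, ctrans a C D -> reaches sigma P D) -> reaches sigma P C.

(** A complete execution is either a single class outside the domain or a step followed by a
    complete execution, to which induction applies. *)
Lemma terminating_of_reaches sigma P C :
  reaches sigma P C -> terminating sigma P C.
Proof.
have nil_leaf e E : complete_execution sigma e -> starts_from e E ->
    (e = FinSeq E [::] /\ sigma E = None) \/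
    exists a D e', [/\ e = ccons E e', sigma E = Some a, ctrans a E D,
      starts_from e' D & complete_execution sigma e'].
  case: (cseqE e) => [[F ->] [_ [[]//|[_ -> FN]]] [<-]|]; first by left.
  move=> [F [e' ->]] ex /starts_from_ccons eFE; rewrite eFE in ex *; right.
  have [D e'D] := starts_from_ex e'.
  by have [[a Ea ED] ex'] := (complete_ccons _ _ e'D).1 ex; exists a, D, e'.
elim=> {}C => [CN CP|a Ca _ IH].
  split=> [e D|e] ex /(nil_leaf _ _ ex) [[-> _]|[a [? [? []]]]]; rewrite ?CN //.
  by move=> /= ->.
split=> [e D|e] ex /(nil_leaf _ _ ex) [[_]|[b [E [e' [-> ]]]]]; rewrite Ca //.
  by move=> [<-] /IH[leafP _] e'E ex' /is_leaf_ccons; exact: leafP.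
by move=> [<-] /IH[_ fin] e'E ex'; apply/finite_ccons/fin.
Qed.

Lemma reaches_universal P : exists tau : strategy M,
  forall sigma C, reaches sigma P C -> reaches tau P C.
Proof.
have [R [antiR minR]] := exists_well_order (strategy M).
pose least C sigma := reaches sigma P C /\
  forall sigma', reaches sigma' P C -> R sigma sigma'.
have leastP C sigma : reaches sigma P C -> exists sigma', least C sigma'.
  move=> rC; have [|tau] := minR [set tau | reaches tau P C].
    by exists sigma.
  by exists tau.
(* The glued strategy copies at [C] the least strategy that reaches [P] from [C], and is undefined
   where there is none. *)
pose picks C x := (exists2 sigma : strategy M, least C sigma & x = sigma C) \/
  (x = None /\ ~ exists sigma, least C sigma).
have [f fP] : {f & forall C, picks C (f C)}.
  apply: choice => C.
  have [[sigma ls]|N] := pselect (exists sigma, least C sigma).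
    by exists (sigma C); left; exists sigma.
  by exists None; right.
have fexec C a : f C = Some a -> forall s', eset C s' -> executable a s'.
  case: (fP C) => [[sigma _ ->]|[-> _]] //; exact: strat_exec.
pose tau := Strategy fexec; exists tau => sigma0 C0 r0; apply: contrapT => N0.
pose bad sigma := exists2 C, reaches sigma P C & ~ reaches tau P C.
(* Minimal counterexample: the least strategy that reaches [P] from some class where [tau] does
   not. *)
have [|sigma [C rC NC] sigma_min] := minR bad; first by exists sigma0, C0.
apply: NC; elim: rC => {}C => [CN CP|a Ca rD IH]; apply: contrapT => NC.
all: have rC : reaches sigma P C
  by [exact: reaches_stop | exact: reaches_act rD].
all: case: (fP C) => [[sigma' [rC' min'] fC]|[_ []]]; last exact: leastP rC.
(* [sigma'] is least at [C], hence below [sigma]; it is also a counterexample at [C], hence above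
   [sigma]. So [tau] copies [sigma] at [C]. *)
all: have eqs : sigma' = sigma
  by apply: antiR; [exact: min' | apply: sigma_min; exists C].
all: apply: NC; rewrite eqs in fC.
  by apply: reaches_stop => //=; rewrite fC.
by apply: (@reaches_act _ _ _ a) => //=; rewrite fC.
Qed.

Lemma reaches_override sigma P C a :
  (forall s, eset C s -> executable a s) ->
  (forall D, ctrans a C D -> reaches sigma P D) ->
  exists sigma', reaches sigma' P C.
Proof.
move=> exC rD; have [rC|NC] := pselect (reaches sigma P C).
  by exists sigma.
pose f D := if pselect (D = C) then Some a else sigma D.
have fexec D b : f D = Some b -> forall s, eset D s -> executable b s.
  rewrite /f; case: pselect => [DC|?] /=; last exact: strat_exec.
  by case=> <-; rewrite DC.
pose sigma' := Strategy fexec; exists sigma'.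
(* The change at [C] is harmless: every class on a derivation for [sigma] reaches [P], and [C] does
   not. *)
have sub D : reaches sigma P D -> reaches sigma' P D.
  elim=> {}D => [DN DP|b Db rE IH].
    apply: reaches_stop => //=; rewrite /f; case: pselect => // DC.
    by case: NC; rewrite -DC; exact: reaches_stop.
  apply: reaches_act IH; rewrite /= /f; case: pselect => // DC.
  by case: NC; rewrite -DC; exact: reaches_act rE.
apply: (@reaches_act _ _ _ a) => [|D /rD/sub//].
by rewrite /= /f; case: pselect.
Qed.

Lemma knowhowP P s : knowhow (@sim _ M) (@trans _ M) P s <->
  exists sigma, terminating sigma P (cls s).
Proof.
split=> [kh|[sigma]]; last exact: knowhow_of_terminating.
have [tau tauP] := reaches_universal P.
(* A fixed universal [tau] lets all outcomes share one strategy, and it absorbs each one-action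
   extension. *)
suff /terminating_of_reaches ? : reaches tau P (cls s) by exists tau.
elim: kh => {s} [s Ps|s a ex _ IH].
  have noneP (C : eclass M) (a : act M) : None = Some a ->
    forall s', eset C s' -> executable a s' by [].
  (* The empty strategy stops at once. *)
  by apply: (tauP (Strategy noneP)); exact: reaches_stop.
have [|D [s' [t [ss' Dt s't]]]|sigma] := @reaches_override tau P (cls s) a.
- exact: ex.
- by rewrite (mem_clsE Dt); exact: IH s't.
- exact: tauP.
Qed.

Lemma sat_Kh s g :
  sat s (Kh g) <-> knowhow (@sim _ M) (@trans _ M) [set u | sat u g] s.
Proof.
rewrite knowhowP /=; split=> -[sigma [leafP fin]]; exists sigma; split=> //.
  by move=> e D ex es eD; apply: leafP; exists e.
by move=> D [e [ex es eD]]; exact: leafP eD.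
Qed.

Lemma sat_Imp s f g : sat s (Imp f g) <-> (sat s f -> sat s g).
Proof.
split=> /= [N sf|fg [sf Ng]]; last exact: Ng (fg sf).
by apply: contrapT => Ng; apply: N.
Qed.

Lemma sat_tautology s f : tautology f -> sat s f.
Proof.
(* Valuing each formula by its truth at [s] makes [beval] compute truth. *)
pose v g := `[< sat s g >].
suff vE g : beval v g = `[< sat s g >] by move=> /(_ v); rewrite vE => /asboolP.
by elim: g => //= [g ->|g -> h ->]; rewrite ?asbool_neg ?asbool_and.
Qed.

End Semantics.

(** Both models share one frame, hence one [knowhow]; for [Kh] only the target set changes, and
    monotonicity transfers the equivalence. *)
Lemma sat_subst (PROP : countType) (M : model PROP) (p : PROP) (g : form PROP) :
  let M' := Model (world_nonempty M) (sim_equiv M) (@trans _ M)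
    (fun s => [set q | if q == p then sat s g else Defs.val s q]) in
  forall f (s : world M), sat s (subst p g f) <-> @sat _ M' s f.
Proof.
move=> M'; elim=> [q|f IH|f IHf h IHh|f IH|f IH] s.
- by rewrite /=; case: eqP.
- by rewrite /= IH.
- by rewrite /= IHf IHh.
- by split=> /= sf s' /sf /IH.
- rewrite [subst _ _ _]/= sat_Kh (@sat_Kh _ M').
  by split; apply: knowhowS => u /IH.
Qed.

Theorem theorem3p4 : forall (PROP : countType) (f : form PROP),
  SKH f -> valid f.
Proof.
move=> PROP f.
elim=> {f} [f tf|p q|p|p|p|p|p|p|p|p
  |f g _ IHf _ IHfg|f _ IH|f g _ IH|f g p _ IH];
  move=> M s; have eqM := sim_equiv M; rewrite ?sat_Imp ?sat_Kh.
- exact: sat_tautology.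
- move=> [Kp Kpq] s' ss'.
  have /sat_Imp : sat s' (Imp (Atom p) (Atom q)) := Kpq s' ss'.
  by apply; exact: Kp.
- by apply; exact: (reflexivity s).
- by move=> Kp s' ss' s'' s's''; apply: Kp; exact: transitivity ss' s's''.
- move=> NKp s' ss' Kp; apply: NKp => t st; apply: Kp.
  exact: transitivity (symmetry ss') st.
- exact: knowhow_stop.
- exact: knowhow_known.
- by move=> kh s' ss'; apply: (sat_Kh s' (Atom p)).2; exact: knowhow_sim ss' kh.
- move=> kh; apply: (knowhow_idem (@Equivalence_Reflexive _ _ eqM)).
  by apply: knowhowS kh => t; exact: (sat_Kh t (Atom p)).1.
- move=> kh; have simxx := @Equivalence_Reflexive _ _ eqM.
  case: (knowhow0 (trans := @trans _ M) (s := s) simxx).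
  by apply: knowhowS kh => t [].
- by have /sat_Imp := IHfg M s; apply; exact: IHf.
- by move=> s' _; exact: IH.
- by apply: knowhowS => t; have /sat_Imp := IH M t.
(* The hypothesis is used in the revalued model, hence the induction on validity in all models. *)
- by apply/sat_subst; exact: IH.
Qed.
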